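(* The class of focus/directrix circles in $\mathbb{H}^2$ does not coincide with the class of circles in any of the following four senses: (a) metric circles; (b) circles obtained as sections of right circular cones in $\mathbb{H}^3$; (c) circles in the algebraic sense; (d) two-focus circles.
   Context: $\mathbb{H}^n$ is hyperbolic $n$-space (constant curvature $-1$) with Riemannian distance $d$. Focus/directrix circle: for a point $a_1$ (the focus), a line (geodesic) $\ell$ not through $a_1$ (the directrix) and $\varepsilon>0$ (the eccentricity), the focus/directrix conic is $\{x\in\mathbb{H}^2 : \sinh d(x,a_1)=\varepsilon\,\sinh d(x,\ell)\}$; it is an ellipse if $\varepsilon<1$. A focus/directrix circle is the limiting case of an ellipse obtained by fixing $a_1$ and sending $\varepsilon\to0$ and $d(a_1,\ell)\to\infty$ while keeping $r=\varepsilon\sinh d(a_1,\ell)>0$ fixed. Explicitly: let $\gamma:[0,\infty)\to\mathbb{H}^2$ be a unit-speed geodesic ray with $\gamma(0)=a_1$, let $\ell_t$ be the line perpendicular to $\gamma$ at $\gamma(t)$, and let $r>0$; the corresponding focus/directrix circle is $\{x\in\mathbb{H}^2 : \sinh d(x,a_1)=\lim_{t\to\infty}\frac{r}{\sinh t}\sinh d(x,\ell_t)\}$. (a) Metric circle: a set $\{x\in\mathbb{H}^2 : d(x,x_1)=r\}$ with $x_1\in\mathbb{H}^2$, $r>0$. (b) Right circular cone in $\mathbb{H}^3$: fix $x_0\in\mathbb{H}^3$, a plane $P$ (totally geodesic copy of $\mathbb{H}^2$) not containing $x_0$, let $x_1$ be the point of $P$ closest to $x_0$, and let $C$ be the metric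 circle in $P$ with center $x_1$ and radius $r>0$; the cone is the union of the geodesics through $x_0$ and a point of $C$, and its axis is the geodesic through $x_0$ and $x_1$. A circle in sense (b) is the nonempty intersection of such a cone with a plane $P'$ in $\mathbb{H}^3$ not containing $x_0$ and perpendicular to the axis, where $P'$ is identified isometrically with $\mathbb{H}^2$. (c) Circle in the algebraic sense: a Euclidean circle (of positive radius) contained in the open unit disk, the disk being viewed as the Klein disk model of $\mathbb{H}^2$ (the model in which the lines of $\mathbb{H}^2$ are the intersections of Euclidean straight lines with the open disk). (d) Two-focus circle: a set $\{x\in\mathbb{H}^2 : d(x,a_1)+d(x,a_2)=c\}$ with $a_1=a_2\in\mathbb{H}^2$ and $c>0$. *)

(* Defs.v *)
From HB Require Import structures.
From mathcomp Require Import all_boot all_order all_algebra.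
From mathcomp Require Import all_classical all_reals all_analysis.

Set Implicit Arguments.
Unset Strict Implicit.
Unset Printing Implicit Defensive.

Import Order.TTheory GRing.Theory Num.Theory.
Import numFieldNormedType.Exports.

Local Open Scope classical_set_scope.
Local Open Scope ring_scope.

Section HyperbolicFunctions.
Variable R : realType.

Definition sinh (t : R) : R := (expR t - expR (- t)) / 2.
Definition cosh (t : R) : R := (expR t + expR (- t)) / 2.

(* inverse of [cosh] on the nonnegative reals; meaningful for [1 <= y] *)
Definition arcosh (y : R) : R := ln (y + Num.sqrt (y ^+ 2 - 1)).

End HyperbolicFunctions.

(* Hyperboloid model: H^n is the upper sheet of [mink x x = -1] in R^(n+1),
   with coordinate [ord0] as the time coordinate. *)
Section HyperbolicSpace.
Variables (R : realType) (n : nat).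

Definition mink (x y : 'rV[R]_n.+1) : R :=
  - (x 0 ord0 * y 0 ord0)
  + \sum_(j < n) x 0 (lift ord0 j) * y 0 (lift ord0 j).

Record hyp : Type := Hyp {
  hv :> 'rV[R]_n.+1;
  _ : (mink hv hv == -1) && (0 < hv 0 ord0) }.

HB.instance Definition _ := [isSub for hv].
HB.instance Definition _ := [Choice of hyp by <:].

Definition hdist (x y : hyp) : R := arcosh (- mink x y).

Definition hdist_set (x : hyp) (A : set hyp) : R := inf [set hdist x y | y in A].

(* The tangent space at [p] is the [mink]-orthogonal complement of [p]; [mink]
   restricted to it is the Riemannian metric. *)
Definition utangent (p : hyp) (v : 'rV[R]_n.+1) : Prop :=
  mink p v = 0 /\ mink v v = 1.

(* the unit-speed geodesic with initial point [p] and initial velocity [v] *)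
Definition geo (p : hyp) (v : 'rV[R]_n.+1) (t : R) : 'rV[R]_n.+1 :=
  cosh t *: (p : 'rV[R]_n.+1) + sinh t *: v.

(* the derivative of [geo p v] *)
Definition geo_velocity (p : hyp) (v : 'rV[R]_n.+1) (t : R) : 'rV[R]_n.+1 :=
  sinh t *: (p : 'rV[R]_n.+1) + cosh t *: v.

Definition line_of (p : hyp) (v : 'rV[R]_n.+1) : set hyp :=
  [set x | exists t : R, (x : 'rV[R]_n.+1) = geo p v t].

Definition is_line (L : set hyp) : Prop :=
  exists p v, utangent p v /\ L = line_of p v.

(* Totally geodesic hypersurfaces: sections of the hyperboloid by linear
   hyperplanes with spacelike normal. For [n = 3] these are the planes. *)
Definition is_hyperplane (P : set hyp) : Prop :=
  exists m : 'rV[R]_n.+1, mink m m = 1 /\ P = [set x : hyp | mink x m = 0].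

(* [L] meets [P] at a point [q] where its direction is orthogonal to the
   direction of every line of [P] through [q] *)
Definition line_perp_hyperplane (L P : set hyp) : Prop :=
  exists q v, [/\ utangent q v, L = line_of q v, P q &
    forall w, utangent q w -> line_of q w `<=` P -> mink v w = 0].

Definition closest_point (x : hyp) (A : set hyp) (y : hyp) : Prop :=
  A y /\ forall z, A z -> hdist x y <= hdist x z.

End HyperbolicSpace.

Definition isometry_onto (R : realType) (m n : nat)
    (phi : hyp R m -> hyp R n) (A : set (hyp R n)) : Prop :=
  (forall x y, hdist (phi x) (phi y) = hdist x y) /\ range phi = A.

Section Circles.
Variable R : realType.

Definition fd_circles : set (set (hyp R 2)) :=
  [set S | exists (a1 : hyp R 2) (v : 'rV[R]_3) (gamma : R -> hyp R 2)
             (ell : R -> set (hyp R 2)) (r : R),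
    [/\ utangent a1 v,
        forall t, 0 <= t -> (gamma t : 'rV[R]_3) = geo a1 v t,
        forall t, 0 <= t -> exists w,
          [/\ utangent (gamma t) w, mink w (geo_velocity a1 v t) = 0
            & ell t = line_of (gamma t) w],
        0 < r
      & S = [set x | r / sinh t * sinh (hdist_set x (ell t)) @[t --> +oo]
                       --> sinh (hdist x a1)]]].

Definition metric_circles : set (set (hyp R 2)) :=
  [set S | exists (x1 : hyp R 2) (r : R),
    0 < r /\ S = [set x | hdist x x1 = r]].

Definition circular_cone (x0 : hyp R 3) (C : set (hyp R 3)) : set (hyp R 3) :=
  [set z | exists y L, [/\ C y, is_line L, L x0, L y & L z]].

Definition cone_circles : set (set (hyp R 2)) :=
  [set S | exists (x0 x1 : hyp R 3) (P : set (hyp R 3)) (r : R)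
             (axis P' : set (hyp R 3)) (phi : hyp R 2 -> hyp R 3),
    let cone := circular_cone x0 [set x | P x /\ hdist x x1 = r] in
    [/\ [/\ is_hyperplane P, ~ P x0, closest_point x0 P x1 & 0 < r],
        [/\ is_line axis, axis x0 & axis x1],
        [/\ is_hyperplane P', ~ P' x0 & line_perp_hyperplane axis P'],
        cone `&` P' !=set0
      & isometry_onto phi P' /\ S = phi @^-1` (cone `&` P')]].

(* projection of the hyperboloid from the origin onto the unit disk at height 1 *)
Definition klein (x : hyp R 2) : 'rV[R]_2 :=
  \row_j (x 0 (lift ord0 j) / x 0 ord0).

(* identifications of H^2 with the Klein disk *)
Definition klein_chart (kappa : hyp R 2 -> 'rV[R]_2) : Prop :=
  exists phi : hyp R 2 -> hyp R 2, isometry_onto phi setT /\ kappa = klein \o phi.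

Definition open_unit_disk : set 'rV[R]_2 :=
  [set u | \sum_(j < 2) u 0 j ^+ 2 < 1].

Definition euclidean_circle (c : 'rV[R]_2) (rho : R) : set 'rV[R]_2 :=
  [set u | \sum_(j < 2) (u 0 j - c 0 j) ^+ 2 = rho ^+ 2].

(* This class is not invariant under the isometries of H^2, so it depends on
   the identification [kappa]. *)
Definition algebraic_circles (kappa : hyp R 2 -> 'rV[R]_2) :
    set (set (hyp R 2)) :=
  [set S | exists (c : 'rV[R]_2) (rho : R),
    [/\ 0 < rho, euclidean_circle c rho `<=` open_unit_disk
      & S = kappa @^-1` euclidean_circle c rho]].

Definition two_focus_circles : set (set (hyp R 2)) :=
  [set S | exists (a1 a2 : hyp R 2) (c : R),
    [/\ a1 = a2, 0 < c & S = [set x | hdist x a1 + hdist x a2 = c]]].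

End Circles.

Arguments fd_circles R : clear implicits.
Arguments metric_circles R : clear implicits.
Arguments cone_circles R : clear implicits.
Arguments two_focus_circles R : clear implicits.

(* Main.v *)
(* The focus/directrix circle with r = 1 is, in the Klein disk centred at the
   focus, the parabola Y^2 = 1 - 2 X; it reaches the boundary circle, hence is
   unbounded.  Circles in each of the four other senses are bounded.  For the
   cone sections, write z = al x0 + be y with y on the base circle: the products
   of y with x0, x1 and the direction of the axis do not depend on y, so
   [mink z z = -1] and z in P' determine al^2 and be^2. *)
Require Import Defs.
From mathcomp Require Import all_boot all_order all_algebra.
From mathcomp Require Import all_classical all_reals all_analysis.
From mathcomp Require Import ring lra.
Set Implicit Arguments.
Unset Strict Implicit.
Unset Printing Implicit Defensive.
Import Order.TTheory GRing.Theory Num.Theory.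
Import numFieldNormedType.Exports.
Local Open Scope classical_set_scope.
Local Open Scope ring_scope.

(** * Hyperbolic functions *)

Lemma cosh2_sinh2 (R : realType) (t : R) : cosh t ^+ 2 - sinh t ^+ 2 = 1.
Proof. by rewrite -[RHS](expRxMexpNx_1 t) /cosh /sinh; field. Qed.

Lemma cosh_gt0 (R : realType) (t : R) : 0 < cosh t.
Proof. by rewrite divr_gt0// addr_gt0// expR_gt0. Qed.

Lemma sinh_gt0 (R : realType) (t : R) : 0 < t -> 0 < sinh t.
Proof. by move=> t0; rewrite divr_gt0// subr_gt0 ltr_expR; lra. Qed.

Lemma sinhB (R : realType) (s t : R) :
  sinh (t - s) = cosh s * sinh t - cosh t * sinh s.
Proof. by rewrite /sinh /cosh opprB !expRD; field. Qed.

Lemma sinh_eq0 (R : realType) (t : R) : sinh t = 0 -> t = 0.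
Proof.
move=> /eqP; rewrite mulf_eq0 invr_eq0 pnatr_eq0 orbF subr_eq0 => /eqP.
by move=> /expR_inj; lra.
Qed.

(** * Inversion and monotonicity of [arcosh] on [1, +oo) *)

Section Arcosh.
Variable R : realType.
Implicit Type y : R.

Lemma sqrt_arcosh y : 1 <= y -> Num.sqrt (y ^+ 2 - 1) ^+ 2 = y ^+ 2 - 1.
Proof. by move=> y1; rewrite sqr_sqrtr// subr_ge0 expr_ge1//; lra. Qed.

Lemma arcosh_arg_gt0 y : 1 <= y -> 0 < y + Num.sqrt (y ^+ 2 - 1).
Proof. by move=> y1; have := sqrtr_ge0 (y ^+ 2 - 1); lra. Qed.

Lemma expR_arcosh y : 1 <= y -> expR (arcosh y) = y + Num.sqrt (y ^+ 2 - 1).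
Proof. by move=> y1; rewrite lnK// posrE arcosh_arg_gt0. Qed.

Lemma expR_N_arcosh y :
  1 <= y -> expR (- arcosh y) = y - Num.sqrt (y ^+ 2 - 1).
Proof.
move=> y1; rewrite expRN expR_arcosh//.
have z0 := arcosh_arg_gt0 y1; apply: (mulfI (lt0r_neq0 z0)).
rewrite mulfV ?lt0r_neq0//; have := sqrt_arcosh y1.
by set r := Num.sqrt _ => rE; apply/esym; rewrite -(subKr (y ^+ 2) 1) -rE; ring.
Qed.

Lemma arcoshK y : 1 <= y -> cosh (arcosh y) = y.
Proof. by move=> y1; rewrite /cosh expR_N_arcosh// expR_arcosh//; field. Qed.

Lemma sinh_arcosh y : 1 <= y -> sinh (arcosh y) = Num.sqrt (y ^+ 2 - 1).
Proof. by move=> y1; rewrite /sinh expR_N_arcosh// expR_arcosh//; field. Qed.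

Lemma le_arcosh y z : 1 <= y -> 1 <= z -> (arcosh y <= arcosh z) = (y <= z).
Proof.
have mono (a b : R) : 1 <= a -> a <= b -> arcosh a <= arcosh b.
  move=> a1 ab; have b1 := le_trans a1 ab.
  have ab2 : a ^+ 2 <= b ^+ 2 by rewrite ler_sqr ?nnegrE; lra.
  rewrite /arcosh ler_ln ?posrE; [|exact: arcosh_arg_gt0..].
  by apply: lerD => //; apply: ler_wsqrtr; rewrite lerB.
move=> y1 z1; apply/idP/idP => [yz|]; last exact: mono.
rewrite leNgt; apply/negP => zy.
have : arcosh y = arcosh z by apply/le_anti; rewrite yz mono// ltW.
by move=> /(congr1 (@cosh R)); rewrite !arcoshK//; lra.
Qed.

End Arcosh.

(** * Minkowski geometry of the hyperboloid *)

Section Minkowski.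
Variables (R : realType) (n : nat).
Implicit Types (u v w : 'rV[R]_n.+1) (x y z : hyp R n) (a b : R).

Lemma minkC u v : mink u v = mink v u.
Proof.
by rewrite /mink mulrC; congr (_ + _); apply: eq_bigr => j _; rewrite mulrC.
Qed.

Lemma minkDl u v w : mink (u + v) w = mink u w + mink v w.
Proof.
rewrite /mink mxE mulrDl opprD addrACA; congr (_ + _).
by rewrite -big_split; apply: eq_bigr => j _; rewrite mxE mulrDl.
Qed.

Lemma minkZl a u w : mink (a *: u) w = a * mink u w.
Proof.
rewrite /mink mxE mulrDr mulrN mulrA; congr (_ + _).
by rewrite mulr_sumr; apply: eq_bigr => j _; rewrite mxE mulrA.
Qed.

Lemma minkDr u v w : mink u (v + w) = mink u v + mink u w.
Proof. by rewrite !(minkC u) minkDl. Qed.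

Lemma minkZr a u w : mink u (a *: w) = a * mink u w.
Proof. by rewrite !(minkC u) minkZl. Qed.

Definition minkE := (minkDl, minkDr, minkZl, minkZr).

Lemma hyp_mink x : mink x x = -1.
Proof. by case: x => x /= /andP[/eqP]. Qed.

Lemma hyp_gt0 x : 0 < (x : 'rV[R]_n.+1) 0 ord0.
Proof. by case: x => x /= /andP[]. Qed.

Lemma hypP x y : (x : 'rV[R]_n.+1) = y -> x = y.
Proof. exact: val_inj. Qed.

Lemma sqr_space_hyp x :
  \sum_(j < n) (x : 'rV[R]_n.+1) 0 (lift ord0 j) ^+ 2
  = (x : 'rV[R]_n.+1) 0 ord0 ^+ 2 - 1.
Proof.
have := hyp_mink x; rewrite /mink; under eq_bigr do rewrite -expr2.
by lra.
Qed.

(* The right-hand side is the squared norm of the spatial part of a u + b v. *)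
Lemma space_sqr_expand u v a b :
  0 <= a ^+ 2 * (mink u u + u 0 ord0 ^+ 2)
     + b ^+ 2 * (mink v v + v 0 ord0 ^+ 2)
     + 2 * a * b * (mink u v + u 0 ord0 * v 0 ord0).
Proof.
pose s w w' := \sum_(j < n) w 0 (lift ord0 j) * w' 0 (lift ord0 j) : R.
have sE w w' : mink w w' + w 0 ord0 * w' 0 ord0 = s w w'.
  by rewrite /mink addrAC addNr add0r.
rewrite !expr2 !sE; set rhs := (X in 0 <= X).
suff -> : rhs = \sum_(j < n) (a * u 0 (lift ord0 j) + b * v 0 (lift ord0 j)) ^+ 2.
  by apply: sumr_ge0 => j _; exact: sqr_ge0.
rewrite /rhs /s !mulr_sumr -!big_split; apply: eq_bigr => j _ /=.
by ring.
Qed.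


(** The spatial parts of [t x - s y] and [t x + s y] have nonnegative squared norm. The first
    inequality bounds the time coordinate of a point near a given one, the second bounds a distance
    by time coordinates. *)
Lemma hyp_mink_bounds x y :
  let s := x 0 ord0 in let t := y 0 ord0 in
  s ^+ 2 + t ^+ 2 <= 2 * s * t * - mink x y /\ - mink x y <= 2 * s * t.
Proof.
move=> s t; have := space_sqr_expand x y t (- s).
have := space_sqr_expand x y t s.
rewrite !hyp_mink -/s -/t => h1 h2.
have := hyp_gt0 x; have := hyp_gt0 y; rewrite -/s -/t => t0 s0.
have st0 := mulr_gt0 s0 t0; have s2 := sqr_ge0 s; have t2 := sqr_ge0 t.
split; first by lra.
by rewrite -(ler_pM2l st0); lra.
Qed.

Lemma hyp_mink_ge1 x y : 1 <= - mink x y.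
Proof.
have [+ _] := hyp_mink_bounds x y.
have := hyp_gt0 x; have := hyp_gt0 y.
set s := x 0 ord0; set t := y 0 ord0 => t0 s0 h.
have st0 := mulr_gt0 s0 t0; have st2 := sqr_ge0 (s - t).
by rewrite -(ler_pM2l st0); lra.
Qed.

Lemma time_le x y : x 0 ord0 <= 2 * y 0 ord0 * - mink x y.
Proof.
have [+ _] := hyp_mink_bounds x y.
have := hyp_gt0 x; set s := x 0 ord0; set t := y 0 ord0 => s0 h.
by rewrite -(ler_pM2l s0); have := sqr_ge0 t; lra.
Qed.

Lemma cosh_hdist x y : cosh (hdist x y) = - mink x y.
Proof. by rewrite arcoshK// hyp_mink_ge1. Qed.

(** If the time coordinate of [u] were nonpositive, the combination of [u] and [x] that cancels the
    time coordinate would have a negative square, although it is purely spatial. *)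
Lemma future_timelike u x : mink u u = -1 -> mink u x < 0 -> 0 < u 0 ord0.
Proof.
move=> uu ux; rewrite ltNge; apply/negP => u0.
have := space_sqr_expand u x (x 0 ord0) (- u 0 ord0).
have := hyp_gt0 x; rewrite uu hyp_mink.
move: (u 0 ord0) (x 0 ord0) (mink u x) ux u0 => s t m m0 s0 t0 h.
have : 0 <= t * (s * m) by apply: mulr_ge0; [lra|nra].
by nra.
Qed.

(* The orthogonal complement of a timelike vector is positive definite. *)
Lemma timelike_perp p w : mink p p < 0 -> mink p w = 0 ->
  0 <= mink w w /\ (mink w w <= 0 -> w = 0).
Proof.
(* These weights cancel the time coordinate, which leaves [b ^+ 2 * mink p p + a ^+ 2 * mink w w >=
   0]. The weights 1 and 0 below show that [a] is nonzero. *)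
move=> pp pw; have := space_sqr_expand p w (- w 0 ord0) (p 0 ord0).
have := space_sqr_expand p w 1 0.
rewrite pw; set a := p 0 ord0; set b := w 0 ord0 => h1 h2.
have a0 : 0 < a ^+ 2 by nra.
have ww0 : 0 <= mink w w by rewrite -(ler_pM2l a0); nra.
split=> // ww1; have wwE : mink w w = 0 by apply/le_anti; rewrite ww0 ww1.
have b0 : b = 0.
  apply/eqP; rewrite -sqrf_eq0; apply/eqP/le_anti; rewrite sqr_ge0 andbT.
  by rewrite wwE in h2; nra.
move: wwE; rewrite /mink -/b b0 mul0r oppr0 add0r => /eqP.
under eq_bigr do rewrite -expr2.
rewrite psumr_eq0; last by move=> j _; exact: sqr_ge0.
move=> /allP w0; apply/rowP => j; rewrite mxE.
case: (unliftP ord0 j) => [i|] -> //.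
by have := w0 i (mem_index_enum i); rewrite /= sqrf_eq0 => /eqP.
Qed.

(** If [x] and [y] have parameters [s] and [t], the passage from [p], [v] to [x], [y] has
    determinant [sinh (t - s)], which is nonzero; the coefficients come from Cramer's rule. *)
Lemma line_span p v x y : line_of p v x -> line_of p v y -> x <> y ->
  forall a b, exists c d,
    a *: (p : 'rV[R]_n.+1) + b *: v
    = c *: (x : 'rV[R]_n.+1) + d *: (y : 'rV[R]_n.+1).
Proof.
move=> [s xE] [t yE] xy a b.
have d0 : cosh s * sinh t - cosh t * sinh s != 0.
  rewrite -sinhB; apply/eqP => /sinh_eq0 ts.
  by apply: xy; apply: hypP; rewrite xE yE; congr geo; lra.
exists ((a * sinh t - b * cosh t) / (cosh s * sinh t - cosh t * sinh s)).
exists ((b * cosh s - a * sinh s) / (cosh s * sinh t - cosh t * sinh s)).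
rewrite xE yE /geo; apply/rowP => j; rewrite !mxE.
by field.
Qed.

(** The closest point is the normalized orthogonal projection [p] of [x] to the hyperplane:
    [x = k p + s m], and the term in [m] vanishes against vectors of the hyperplane. *)
Lemma closest_point_mink (m : 'rV[R]_n.+1) x x1 : mink m m = 1 ->
  closest_point x [set y | mink y m = 0] x1 ->
  exists k, forall y, mink y m = 0 -> mink y x = k * mink y x1.
Proof.
move=> mm [/= x1m x1min]; pose s := mink x m.
pose k := Num.sqrt (1 + s ^+ 2).
have kE : k ^+ 2 = 1 + s ^+ 2 by rewrite sqr_sqrtr// addr_ge0// sqr_ge0.
have k0 : 0 < k by rewrite sqrtr_gt0 ltr_pwDl// sqr_ge0.
have kn0 : k != 0 by rewrite gt_eqF.
pose p : 'rV[R]_n.+1 := k^-1 *: ((x : 'rV[R]_n.+1) + (- s) *: m).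
have pE : (x : 'rV[R]_n.+1) = k *: p + s *: m.
  by apply/rowP => j; rewrite !mxE; field.
have mx : mink m x = s by rewrite minkC.
have pp : mink p p = -1.
  by rewrite /p !minkE hyp_mink mm mx -/s; field: kE.
have px : mink p x = - k.
  by rewrite /p !minkE hyp_mink mx; field: kE.
have pm : mink p m = 0 by rewrite /p !minkE mm -/s; ring.
have p0 : 0 < p 0 ord0 by apply: (future_timelike (x := x)) => //; lra.
clearbody p; have pH : (mink p p == -1) && (0 < p 0 ord0) by rewrite pp eqxx.
pose y := Hyp pH; exists k => z zm.
suff -> : (x1 : 'rV[R]_n.+1) = p by rewrite pE !minkE zm; ring.
have := x1min y pm; rewrite le_arcosh ?hyp_mink_ge1//=.
rewrite (minkC x p) px opprK pE !minkE => le1.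
have mx1 : mink m x1 = 0 by rewrite minkC.
have px1 : mink p x1 >= -1.
  by rewrite -(ler_pM2l k0); move: le1; rewrite mx1; lra.
have x1p : mink x1 p = mink p x1 by exact: minkC.
(* Minimality gives [mink p x1 >= -1], hence [mink w w <= 0]; but [w] is orthogonal to the timelike
   vector [x1 + p], so it vanishes. *)
pose w := (x1 : 'rV[R]_n.+1) + (-1) *: p.
suff w0 : w = 0 by apply/eqP; rewrite -subr_eq0 -scaleN1r; apply/eqP.
have := hyp_mink_ge1 y x1 => /= px1'.
have [||_] := @timelike_perp ((x1 : 'rV[R]_n.+1) + p) w.
- by rewrite !minkE hyp_mink pp x1p; lra.
- by rewrite /w !minkE hyp_mink pp x1p; ring.
- by apply; rewrite /w !minkE hyp_mink pp x1p; lra.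
Qed.

(** The direction of a perpendicular line is itself a normal of the hyperplane. Otherwise its part
    [w] tangent to the hyperplane, normalized, would direct a line of [P] through [q], and
    perpendicularity would force [mink w w = mink v w = 0]. *)
Lemma perp_hyperplane_mink (L P : set (hyp R n)) (m : 'rV[R]_n.+1) :
    mink m m = 1 -> P = [set x | mink x m = 0] ->
    line_perp_hyperplane L P ->
  exists p v, L = line_of p v /\ forall x, P x <-> mink x v = 0.
Proof.
move=> mm -> [q [v [[qv vv] -> /= qm perp]]]; exists q, v; split=> //.
pose c := mink v m; have [w wE] : exists w, w = v + (- c) *: m by eexists.
have mv : mink m v = c by exact: minkC.
have qw : mink q w = 0 by rewrite wE !minkE qv qm; ring.
have mw : mink m w = 0 by rewrite wE !minkE mm mv; ring.
have vw : mink v w = mink w w.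
  by rewrite [X in _ = mink X _]wE minkDl minkZl mw; ring.
have [||ww0] := @timelike_perp q w => //; first by rewrite hyp_mink; lra.
suff ww : mink w w <= 0.
  move=> /(_ ww) w0; have vE : v = c *: m.
    by apply/eqP; rewrite -subr_eq0 -scaleNr -wE w0.
  have c0 : c != 0.
    apply/eqP => c0; move: vv; rewrite vE c0 !minkE !mul0r => /esym/eqP.
    by rewrite oner_eq0.
  move=> x; rewrite vE minkZr; split=> [->|/eqP]; rewrite ?mulr0//.
  by rewrite mulf_eq0 (negbTE c0) => /eqP.
rewrite leNgt; apply/negP => ww.
pose s := Num.sqrt (mink w w).
have s0 : 0 < s by rewrite sqrtr_gt0.
have sE : s ^+ 2 = mink w w by rewrite sqr_sqrtr// ltW.
have := perp (s^-1 *: w); rewrite !minkZr vw => H.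
suff /eqP : s^-1 * mink w w = 0.
  by rewrite mulf_eq0 invr_eq0 !gt_eqF.
apply: H => [|x [t xE] /=]; last first.
  by rewrite xE /geo !minkE (minkC w m) mw qm; ring.
split; rewrite !minkE ?qw ?mulr0// -sE; field.
by rewrite gt_eqF.
Qed.

End Minkowski.

(** * Boundedness of circles in the four other senses *)

Section Bounded.
Variable R : realType.

Definition hbounded n (S : set (hyp R n)) : Prop :=
  exists p M, forall x, S x -> hdist x p <= M.

(** The time coordinate is [cosh] of the distance to the vertex of the hyperboloid, so this is
    boundedness in a form suited to linear algebra. *)
Definition time_bounded n (S : set (hyp R n)) : Prop :=
  exists K, forall x, S x -> x 0 ord0 <= K.

Lemma isometry_time_bounded m n (phi : hyp R m -> hyp R n) A T (x0 : hyp R m) :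
  isometry_onto phi A -> time_bounded T -> hbounded (phi @^-1` T).
Proof.
move=> [iso _] [K TK]; pose p := phi x0.
(* The maximum with 1 keeps the argument where [arcosh] is monotone, whatever [K] is. *)
exists x0, (arcosh (Num.max 1 (2 * K * p 0 ord0))) => x Tx.
rewrite -iso -/p le_arcosh ?hyp_mink_ge1 ?le_max ?lexx//.
apply/orP; right; have [_] := hyp_mink_bounds (phi x) p.
move/le_trans; apply; apply: ler_wpM2r; first exact: ltW (hyp_gt0 p).
by rewrite ler_pM2l//; exact: TK.
Qed.

Lemma hyp_ge1 n (x : hyp R n) : 1 <= x 0 ord0.
Proof.
have : 0 <= x 0 ord0 ^+ 2 - 1.
  by rewrite -sqr_space_hyp; apply: sumr_ge0 => j _; exact: sqr_ge0.
have := hyp_gt0 x; move: (x 0 ord0) => s s0 h.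
by rewrite -(@ler_sqr _ 1 s) ?nnegrE ?expr1n//; lra.
Qed.

Lemma metric_circle_hbounded (S : set (hyp R 2)) :
  metric_circles R S -> hbounded S.
Proof. by move=> [x1 [r [_ ->]]]; exists x1, r => x /= ->. Qed.

Lemma two_focus_circle_hbounded (S : set (hyp R 2)) :
  two_focus_circles R S -> hbounded S.
Proof. by move=> [a [_ [c [<- _ ->]]]]; exists a, (c / 2) => x /=; lra. Qed.

(** The point of the circle farthest from the origin, at distance [d + rho] with [d] the norm of
    [c], still lies in the open disk. *)
Lemma circle_in_disk_radius (c : 'rV[R]_2) (rho : R) : 0 < rho ->
    euclidean_circle c rho `<=` @open_unit_disk R ->
  exists2 M, M < 1 &
    forall u, euclidean_circle c rho u -> \sum_(j < 2) u 0 j ^+ 2 <= M.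
Proof.
move=> rho0 sub; pose a := c 0 ord0; pose b := c 0 (lift ord0 ord0).
pose d := Num.sqrt (a ^+ 2 + b ^+ 2).
have ab0 : 0 <= a ^+ 2 + b ^+ 2 by rewrite addr_ge0// sqr_ge0.
have dE : d ^+ 2 = a ^+ 2 + b ^+ 2 by rewrite sqr_sqrtr.
have d0 : 0 <= d by exact: sqrtr_ge0.
(* A unit vector in the direction of the centre, chosen arbitrarily when the centre is the
   origin. *)
have [e [f [ef1 efd]]] : exists e f, e ^+ 2 + f ^+ 2 = 1 /\ a * e + b * f = d.
  have [d00|dn0] := eqVneq d 0.
    exists 1, 0; split; first by ring.
    by rewrite d00 in dE *; nra.
  exists (a / d), (b / d); split.
    by transitivity ((a ^+ 2 + b ^+ 2) / d ^+ 2); [|rewrite -dE]; field.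
  by transitivity ((a ^+ 2 + b ^+ 2) / d); [|rewrite -dE]; field.
have sum2 (F : 'I_2 -> R) : \sum_(j < 2) F j = F ord0 + F (lift ord0 ord0).
  by rewrite !big_ord_recl big_ord0 addr0.
exists ((d + rho) ^+ 2).
  have := sub (\row_j (c 0 j + rho * (if j == ord0 then e else f))).
  rewrite /euclidean_circle /open_unit_disk /= !sum2 !mxE /= -/a -/b => H.
  have := H _.
  rewrite [X in X = _](_ : _ = rho ^+ 2 * (e ^+ 2 + f ^+ 2)); last by ring.
  rewrite ef1 mulr1 => /(_ erefl); apply: le_lt_trans.
  rewrite [leRHS](_ : _ = a ^+ 2 + b ^+ 2 + rho ^+ 2 * (e ^+ 2 + f ^+ 2)
    + 2 * rho * (a * e + b * f)); last by ring.
  by rewrite ef1 efd -dE; lra.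
move=> u; rewrite /euclidean_circle /= !sum2 -/a -/b.
move: (u 0 ord0) (u 0 (lift ord0 ord0)) => s t h.
set g := a * (s - a) + b * (t - b).
have hE : s ^+ 2 + t ^+ 2 = d ^+ 2 + rho ^+ 2 + 2 * g by rewrite dE -h /g; ring.
suff : g <= d * rho by rewrite hE; lra.
(* Cauchy-Schwarz: the square of [a * (t - b) - b * (s - a)] is the difference
   [(d * rho) ^+ 2 - g ^+ 2]. *)
rewrite leNgt; apply/negP => gt.
have dr0 : 0 <= d * rho by rewrite mulr_ge0// ltW.
have : (d * rho) ^+ 2 < g ^+ 2 by rewrite ltr_sqr// nnegrE; lra.
rewrite exprMn dE -h -subr_gt0 /g; have := sqr_ge0 (a * (t - b) - b * (s - a)).
by lra.
Qed.

Lemma algebraic_circle_hbounded (o : hyp R 2) kappa (S : set (hyp R 2)) :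
  klein_chart kappa -> algebraic_circles kappa S -> hbounded S.
Proof.
move=> [phi [iso ->]] [c [rho [rho0 sub ->]]].
apply: (isometry_time_bounded (T := @klein R @^-1` euclidean_circle c rho) o iso).
have [M M1 uM] := circle_in_disk_radius rho0 sub.
exists (1 - M)^-1 => x /= /uM.
(* The squared Klein radius is 1 minus the inverse square of the time coordinate, so a radius
   bounded away from 1 bounds the time coordinate. *)
have -> : \sum_(j < 2) klein x 0 j ^+ 2 = (x 0 ord0 ^+ 2 - 1) / x 0 ord0 ^+ 2.
  rewrite -sqr_space_hyp mulr_suml; apply: eq_bigr => j _.
  by rewrite mxE exprMn exprVn.
have := hyp_ge1 x; move: (x 0 ord0) => s s1.
have s0 : 0 < s ^+ 2 by rewrite exprn_gt0//; lra.
rewrite ler_pdivrMr// => h.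
have M10 : 0 < 1 - M by lra.
by rewrite -(ler_pM2r M10) mulVf ?gt_eqF//; nra.
Qed.

Lemma cone_circle_hbounded (o : hyp R 2) (S : set (hyp R 2)) :
  cone_circles R S -> hbounded S.
Proof.
move=> [x0 [x1 [P [r [axis [P' [phi]]]]]]] /=.
move=> [[[m [mm ->]] /= Px0 x1cl r0] [_ ax0 ax1]].
move=> [[m' [mm' P'E]] P'x0 perp] _ [iso ->].
apply: (isometry_time_bounded o iso).
have [p [v [axE P'v]]] := perp_hyperplane_mink mm' P'E perp.
have [k kP] := closest_point_mink mm x1cl.
have x01 : x0 <> x1 by move=> E; apply: Px0; rewrite E; exact: x1cl.1.
rewrite axE in ax0 ax1.
(* The axis contains [x0] and [x1], so its direction [v] is a combination of them, and [mink y v]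
   follows from the products of [y] with [x0] and [x1]. *)
have [a [b]] := line_span ax0 ax1 x01 0 1.
rewrite scale0r scale1r add0r => vE.
have A0 : mink x0 v != 0 by apply/eqP => /P'v.
(* For [z = al x0 + be y], the equation [mink z v = 0] forces [al = g * be], and then
   [mink z z = - be ^+ 2 * D]. The constant [T] bounds the time coordinate of [y]. *)
pose g := - (- (a * k + b) * cosh r) / mink x0 v.
pose D := g ^+ 2 + 1 + 2 * g * k * cosh r.
pose T := 2 * x1 0 ord0 * cosh r.
exists ((1 + D^-1) * (`|g| * x0 0 ord0 + T)).
move=> z [[y [L [[Py yr] [p' [v' [_ ->]]] Lx0 Ly Lz]]] /P'v zv].
have yx1 : mink y x1 = - cosh r by rewrite -yr cosh_hdist opprK.
have yx0 : mink y x0 = - k * cosh r by rewrite kP// yx1; ring.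
have yv : mink y v = - (a * k + b) * cosh r by rewrite vE !minkE yx0 yx1; ring.
have x0y : x0 <> y by move=> E; apply: Px0; rewrite E.
have [al [be zE]] : exists al be,
    (z : 'rV[R]_4) = al *: (x0 : 'rV[R]_4) + be *: (y : 'rV[R]_4).
  have [t zt] := Lz; rewrite zt.
  exact: line_span Lx0 Ly x0y (cosh t) (sinh t).
have alE : al = g * be.
  apply: (mulIf A0); rewrite mulrAC divfK// mulrC.
  by move: zv; rewrite zE !minkE yv; lra.
have beD : be ^+ 2 * D = 1.
  have := hyp_mink z; rewrite zE !minkE !hyp_mink (minkC x0 y) yx0 alE /D => h.
  by lra.
have D0 : D != 0.
  by apply: contra_eq_neq beD => ->; rewrite mulr0 eq_sym oner_eq0.
have DV : D^-1 = be ^+ 2 by rewrite -[LHS]mul1r -beD mulfK.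
have yT : y 0 ord0 <= T.
  by have := time_le y x1; rewrite yx1 opprK.
have be1 : `|be| <= 1 + D^-1.
  by rewrite DV -real_normK ?num_real//; have := sqr_ge0 (`|be| - 1); nra.
have x00 := hyp_gt0 x0; have y00 := hyp_gt0 y.
rewrite zE !mxE alE; apply: (le_trans (ler_norm _)).
rewrite (mulrC g) -mulrA -mulrDr.
rewrite normrM; apply: ler_pM => //.
apply: (le_trans (ler_normD _ _)); rewrite normrM.
by rewrite (gtr0_norm x00) (gtr0_norm y00) lerD.
Qed.

End Bounded.

(** * Distance from a point to a line *)

Section DistanceToLine.
Variables (R : realType) (n : nat).
Implicit Types (p x : hyp R n) (w : 'rV[R]_n.+1).

Lemma geo_hyp p w t : utangent p w ->
  (mink (geo p w t) (geo p w t) == -1) && (0 < geo p w t 0 ord0).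
Proof.
move=> [pw ww]; have gg : mink (geo p w t) (geo p w t) = -1.
  rewrite /geo !minkE hyp_mink (minkC w p) pw ww -[RHS]mulN1r.
  by rewrite -(cosh2_sinh2 t); ring.
rewrite gg eqxx; apply: (@future_timelike _ _ _ p) => //.
by rewrite /geo !minkE hyp_mink (minkC w p) pw; have := cosh_gt0 t; lra.
Qed.

(** [N ^+ 2] is the square of the component of [x] orthogonal to [p] and [w]. Along the line, [cosh]
    of the distance is [A cosh s - B sinh s], whose minimum is the square root of
    [A ^+ 2 - B ^+ 2]. *)
Lemma sinh_hdist_line p w x (N : R) : utangent p w ->
  mink x p ^+ 2 = 1 + mink x w ^+ 2 + N ^+ 2 ->
  sinh (hdist_set x (line_of p w)) = `|N|.
Proof.
move=> pw; set A := - mink x p; set B := mink x w => NE.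
have {}NE : A ^+ 2 = 1 + B ^+ 2 + N ^+ 2 by rewrite sqrrN.
have A1 : 1 <= A by exact: hyp_mink_ge1.
pose D := Num.sqrt (1 + N ^+ 2).
have N1 : 0 <= 1 + N ^+ 2 by have := sqr_ge0 N; lra.
have DE : D ^+ 2 = 1 + N ^+ 2 by rewrite sqr_sqrtr.
have D1 : 1 <= D by rewrite -sqrtr1 ler_wsqrtr// lerDl sqr_ge0.
have AB0 : 0 < A + B by have := sqr_ge0 N; nra.
have Dn0 : D != 0 by rewrite gt_eqF//; lra.
have distE y s : (y : 'rV[R]_n.+1) = geo p w s ->
    - mink x y = cosh s * A - sinh s * B.
  by move=> ->; rewrite /geo !minkE /A -/B; ring.
have Dmin y : line_of p w y -> D <= - mink x y.
  move=> [s yE]; rewrite -ler_sqr ?nnegrE; [|lra|]; last first.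
    by have := hyp_mink_ge1 x y; lra.
  rewrite (distE _ _ yE) DE.
  (* This product equals the square of [A cosh s - B sinh s] minus that of [A sinh s - B cosh s]. *)
  have -> : 1 + N ^+ 2 = (A ^+ 2 - B ^+ 2) * (cosh s ^+ 2 - sinh s ^+ 2).
    by rewrite cosh2_sinh2 NE; ring.
  by have := sqr_ge0 (A * sinh s - B * cosh s); lra.
suff -> : hdist_set x (line_of p w) = arcosh D.
  by rewrite sinh_arcosh// DE addrAC subrr add0r sqrtr_sqr.
have lb : lbound [set hdist x y | y in line_of p w] (arcosh D).
  by move=> _ [y /Dmin yD <-]; rewrite le_arcosh// hyp_mink_ge1.
(* The foot of the perpendicular: the minimum is reached where [tanh s = B / A]. *)
pose s := ln ((A + B) / D); pose y := Hyp (geo_hyp s pw).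
have es : expR s = (A + B) / D.
  by rewrite lnK// posrE divr_gt0//; lra.
have ens : expR (- s) = (A - B) / D.
  rewrite expRN es invf_div; apply: (canLR (mulfK _)); first by rewrite gt_eqF.
  rewrite mulrAC -subr_sqr; apply: (mulIf Dn0); rewrite divfK//.
  by rewrite -expr2 DE NE; ring.
have yl : line_of p w y by exists s.
have yE : hdist x y = arcosh D.
  congr arcosh; rewrite (distE y s)// /cosh /sinh es ens.
  transitivity ((A ^+ 2 - B ^+ 2) / D); first by field.
  by apply: (mulIf Dn0); rewrite divfK// -expr2 DE NE; ring.
apply/le_anti/andP; split; last by apply: lb_le_inf => //; exists (arcosh D), y.
by rewrite -yE; apply: ge_inf; [exists (arcosh D)|exists y].
Qed.

End DistanceToLine.

(** * An unbounded focus/directrix circle *)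

Section Parabola.
Variable R : realType.

Lemma cvg_coth : cosh t / sinh t @[t --> +oo] --> (1 : R).
Proof.
have e0 := @cvgr_expR R.
have e20 : expR (- t) * expR (- t) @[t --> +oo] --> (0 : R).
  by rewrite -[X in _ --> X](mulr0 0); exact: cvgM.
(* This is [coth], with numerator and denominator multiplied by [expR (- t)]. *)
have h : (1 + expR (- t) * expR (- t)) / (1 - expR (- t) * expR (- t))
    @[t --> +oo] --> ((1 + 0) / (1 - 0) : R).
  apply: cvgM.
    by apply: cvgD => //; exact: cvg_cst.
  apply: cvgV; first by rewrite subr0 oner_eq0.
  by apply: cvgB => //; exact: cvg_cst.
rewrite addr0 subr0 divr1 in h.
apply: cvg_trans h; apply: near_eq_cvg; near=> t.
have t0 : 0 < t by near: t; exact: nbhs_pinfty_gt.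
have := sinh_gt0 t0; rewrite /cosh /sinh => s0.
have d0 : expR t - expR (- t) != 0 by apply/eqP => E; rewrite E mul0r ltxx in s0.
have := expRxMexpNx_1 t; have := expR_gt0 t; have := expR_gt0 (- t).
move: (expR t) (expR (- t)) d0 => a b d0 b0 a0 ab.
have -> : 1 + b * b = b * (a + b) by rewrite -ab; ring.
have -> : 1 - b * b = b * (a - b) by rewrite -ab; ring.
by field; rewrite d0 !gt_eqF.
Unshelve. all: by end_near. Qed.

Definition vec3 (a b c : R) : 'rV[R]_3 := \row_j nth 0 [:: a; b; c] j.

Local Notation i0 := (ord0 : 'I_3).
Local Notation i1 := (lift ord0 ord0 : 'I_3).
Local Notation i2 := (lift ord0 (lift ord0 ord0) : 'I_3).

Lemma mink3 (u v : 'rV[R]_3) : mink u v =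
  - (u 0 i0 * v 0 i0) + (u 0 i1 * v 0 i1 + u 0 i2 * v 0 i2).
Proof. by rewrite /mink !big_ord_recl big_ord0 addr0. Qed.

Lemma mink_vec3 (u : 'rV[R]_3) a b c :
  mink u (vec3 a b c) = - (u 0 i0 * a) + (u 0 i1 * b + u 0 i2 * c).
Proof. by rewrite mink3 !mxE. Qed.

Lemma origin_hyp :
  (mink (vec3 1 0 0) (vec3 1 0 0) == -1) && (0 < vec3 1 0 0 0 ord0).
Proof. by rewrite mink_vec3 !mxE /= ltr01 andbT; apply/eqP; ring. Qed.

Definition origin : hyp R 2 := Hyp origin_hyp.

Lemma origin_tangent : utangent origin (vec3 0 1 0).
Proof. by split; rewrite mink_vec3 !mxE /=; ring. Qed.

Definition ray (t : R) : hyp R 2 := Hyp (geo_hyp t origin_tangent).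

(** The third axis is orthogonal to the plane spanned by the ray, so one fixed vector directs every
    directrix. *)
Lemma ray_normal t : utangent (ray t) (vec3 0 0 1).
Proof. by split; rewrite mink_vec3 !mxE /=; ring. Qed.

Definition fd_parabola : set (hyp R 2) :=
  [set x | 1 / sinh t * sinh (hdist_set x (line_of (ray t) (vec3 0 0 1)))
             @[t --> +oo] --> sinh (hdist x origin)].

Lemma fd_parabola_circle : fd_circles R fd_parabola.
Proof.
exists origin, (vec3 0 1 0), ray, (fun t => line_of (ray t) (vec3 0 0 1)), 1.
split=> //; first exact: origin_tangent.
move=> t _; exists (vec3 0 0 1); split=> //; first exact: ray_normal.
by rewrite minkC mink_vec3 !mxE /=; ring.
Qed.

(** As [t] grows, the scaled [sinh] of the distance to the directrix tends to [|x1 - x0|] in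
    coordinates, while [sinh] of the distance to the focus is the square root of [x0 ^+ 2 - 1]. *)
Lemma fd_parabolaP (x : hyp R 2) :
  x 0 i0 ^+ 2 - 1 = (x 0 i0 - x 0 i1) ^+ 2 -> fd_parabola x.
Proof.
move=> xE.
have xx : - (x 0 i0 * x 0 i0) + (x 0 i1 * x 0 i1 + x 0 i2 * x 0 i2) = -1.
  by rewrite -mink3 hyp_mink.
rewrite /fd_parabola /=; have -> : sinh (hdist x origin) = `|x 0 i1 - x 0 i0|.
  rewrite sinh_arcosh ?hyp_mink_ge1// /= mink_vec3 !mulr0 !addr0 mulr1 opprK.
  by rewrite xE sqrtr_sqr distrC.
have h : `|x 0 i1 * (cosh t / sinh t) - x 0 i0| @[t --> +oo]
    --> `|x 0 i1 - x 0 i0|.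
  apply: cvg_norm; apply: cvgB; last exact: cvg_cst.
  rewrite -[X in _ --> X]mulr1; apply: cvgM; [exact: cvg_cst|exact: cvg_coth].
apply: cvg_trans h; apply: near_eq_cvg; near=> t.
have t0 : 0 < t by near: t; exact: nbhs_pinfty_gt.
have s0 := sinh_gt0 t0.
(* The value supplied for [N] is the product of [x] with the velocity of the ray at [t], the unit
   normal of the directrix. *)
rewrite (@sinh_hdist_line _ _ _ _ _ (x 0 i1 * cosh t - x 0 i0 * sinh t)).
- rewrite div1r -[X in _ = X * _]gtr0_norm ?invr_gt0// -normrM; congr (`| _ |).
  by field; rewrite gt_eqF.
- exact: ray_normal.
rewrite mink_vec3 /= /geo minkDr !minkZr !mink_vec3.
move: (x 0 i0) (x 0 i1) (x 0 i2) xx => a b c abc.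
have : (a ^+ 2 - b ^+ 2) * (cosh t ^+ 2 - sinh t ^+ 2) = a ^+ 2 - b ^+ 2.
  by rewrite cosh2_sinh2 mulr1.
by lra.
Unshelve. all: by end_near. Qed.

(* In the Klein disk the parabola is [Y ^ 2 = 1 - 2 X], which reaches the
   boundary points (0, 1) and (0, -1); below, [u] parametrizes it by
   [time = (u + 1/u) / 2] and [X * time = 1/u]. *)
Lemma fd_parabola_unbounded : ~ hbounded fd_parabola.
Proof.
(* The value of [u] is chosen to make [(u - u^-1) / 2] exceed [expR M]. *)
move=> [p [M pM]]; pose u : R := 3 + 2 * expR M.
have eM := expR_gt0 M; have u0 : u != 0 by rewrite gt_eqF// /u; lra.
have u3 : 3 <= u by rewrite /u; lra.
have uV : u * u^-1 = 1 by rewrite mulfV.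
have uV0 : 0 < u^-1 by rewrite invr_gt0; lra.
pose a := (u + u^-1) / 2; pose d := (u - u^-1) ^+ 2 / 4 - u^-1 ^+ 2.
have d0 : 0 <= d by rewrite /d; nra.
(* Both square roots of [d] give a point of the parabola; the sign is taken so that the third
   coordinate cannot decrease [- mink x p]. *)
have [c [cE cp]] : exists c, c ^+ 2 = d /\ c * p 0 i2 <= 0.
  have [p2|p2] := leP (p 0 i2) 0.
    exists (Num.sqrt d); split; first by rewrite sqr_sqrtr.
    by rewrite mulr_ge0_le0// sqrtr_ge0.
  exists (- Num.sqrt d); split; first by rewrite sqrrN sqr_sqrtr.
  by rewrite mulNr oppr_le0 mulr_ge0 ?sqrtr_ge0// ltW.
have xH : (mink (vec3 a u^-1 c) (vec3 a u^-1 c) == -1)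
    && (0 < vec3 a u^-1 c 0 ord0).
  apply/andP; split; last by rewrite mxE /= /a; lra.
  by rewrite mink_vec3 !mxE /= -!expr2 cE /d /a; apply/eqP; field.
pose x := Hyp xH.
have : fd_parabola x by apply: fd_parabolaP; rewrite /= !mxE /= /a; field.
move=> /pM; rewrite -ler_expR expR_arcosh ?hyp_mink_ge1//.
rewrite leNgt => /negP; apply.
apply: (@lt_le_trans _ _ (- mink x p)); last by rewrite lerDl sqrtr_ge0.
rewrite minkC /= mink_vec3.
have := hyp_ge1 p; have := hyp_mink p; rewrite mink3.
move: (p 0 i0) (p 0 i1) (p 0 i2) cp => p0 p1 p2 cp pp p0_1.
(* Replacing [p1] by [p0] bounds [- mink x p] below by [p0 * (a - u^-1)], which is
   [p0 * ((u - u^-1) / 2)]. *)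
have p10 : p1 <= p0 by have := sqr_ge0 p2; nra.
have h1 : p1 * u^-1 <= p0 * u^-1 by rewrite ler_pM2r.
have V1 : u^-1 <= 1 by rewrite invf_le1//; lra.
have h2 : (u - u^-1) / 2 <= p0 * ((u - u^-1) / 2) by nra.
suff : expR M < (u - u^-1) / 2 by move: h1 h2; rewrite /a; lra.
by rewrite {1}/u; lra.
Qed.
End Parabola.

Theorem theorem11 (R : realType) :
  [/\ fd_circles R <> metric_circles R,
      fd_circles R <> cone_circles R,
      (forall kappa : hyp R 2 -> 'rV[R]_2, klein_chart kappa ->
         fd_circles R <> algebraic_circles kappa)
      /\ fd_circles R <>
           [set S | exists kappa, klein_chart kappa /\ algebraic_circles kappa S]
    & fd_circles R <> two_focus_circles R].
Proof.
have unbounded_neq (C : set (set (hyp R 2))) :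
    (forall S, C S -> hbounded S) -> fd_circles R <> C.
  move=> CB E; apply: (@fd_parabola_unbounded R); apply: CB; rewrite -E.
  exact: fd_parabola_circle.
split.
- exact/unbounded_neq/metric_circle_hbounded.
- by apply: unbounded_neq => S /(cone_circle_hbounded (origin R)).
- split=> [kappa kc|]; apply: unbounded_neq => S.
    by move=> /(algebraic_circle_hbounded (origin R) kc).
  by move=> [kappa [kc /(algebraic_circle_hbounded (origin R) kc)]].
- exact/unbounded_neq/two_focus_circle_hbounded.
Qed.
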